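(* Let $G$ be a square and let $H$ be any graph. Then both lexicographic products $G\circ H$ and $H\circ G$ are squares.
   Context: For graphs $X,Y$, the lexicographic product $X\circ Y$ has vertex set $V(X)\times V(Y)$, with $(x,y)$ adjacent to $(x',y')$ iff either $xx'\in E(X)$, or $x=x'$ and $yy'\in E(Y)$. All graphs are finite, simple, with nonempty vertex sets. A partially labeled graph is a graph $K$ together with an injective map $\theta: L\to V(K)$, $L\subseteq\mathbb{N}$, whose image $\theta(L)$ is nonempty and a proper subset of $V(K)$; vertices in $\theta(L)$ are labeled. The square $KK$ is obtained from two disjoint copies of $K$ by identifying each labeled vertex $\theta(\ell)$ of the first copy with $\theta(\ell)$ of the second copy (keeping all edges, merging double edges). A graph is a square if it is isomorphic to $KK$ for some partially labeled graph $K$. *)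

(* Defs.v *)
From mathcomp Require Import all_boot finmap.

Set Implicit Arguments.
Unset Strict Implicit.
Unset Printing Implicit Defensive.

Record sgraph := SGraph {
  vertex :> finType;
  adj : rel vertex;
  adj_sym : symmetric adj;
  adj_irrefl : irreflexive adj;
  vertex_gt0 : 0 < #|vertex|
}.

Definition isomorphic (X Y : sgraph) : Prop :=
  exists2 f : X -> Y, bijective f & forall x x', adj (f x) (f x') = adj x x'.

Section Lexicographic.
Variables X Y : sgraph.

Definition lex_adj : rel (X * Y) :=
  fun p q => adj p.1 q.1 || ((p.1 == q.1) && adj p.2 q.2).

Lemma lex_adj_sym : symmetric lex_adj.
Proof. by move=> p q; rewrite /lex_adj adj_sym eq_sym (adj_sym p.2). Qed.

Lemma lex_adj_irrefl : irreflexive lex_adj.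
Proof. by move=> p; rewrite /lex_adj !adj_irrefl andbF. Qed.

Lemma lex_vertex_gt0 : 0 < #|{: X * Y}|.
Proof. by rewrite card_prod muln_gt0 !vertex_gt0. Qed.

Definition lexprod : sgraph :=
  SGraph lex_adj_sym lex_adj_irrefl lex_vertex_gt0.
End Lexicographic.

(* The set of labels is taken finite, which loses nothing: it injects into   *)
(* the finite vertex set.                                                    *)
Record plgraph := PLGraph {
  plg :> sgraph;
  labels : {fset nat};
  theta : labels -> plg;
  theta_inj : injective theta;
  theta_nonempty : exists v, v \in codom theta;
  theta_proper : exists v, v \notin codom theta
}.

Section Square.
Variable K : plgraph.

(* The vertex (b, v) of the disjoint union of two copies of K is the vertex v *)
(* of copy b.                                                                 *)
Definition copies_adj : rel (bool * K) :=
  fun p q => (p.1 == q.1) && adj p.2 q.2.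

Definition glue : rel (bool * K) :=
  fun p q => (p == q) ||
    [exists l : labels K, (p.2 == theta l) && (q.2 == theta l)].

Lemma glue_snd p q : glue p q -> p.2 = q.2.
Proof. by case/orP=> [/eqP->//|/existsP[l /andP[/eqP-> /eqP->]]]. Qed.

Lemma glue_refl : reflexive glue.
Proof. by move=> p; rewrite /glue eqxx. Qed.

Lemma glue_sym : symmetric glue.
Proof.
move=> p q; rewrite /glue eq_sym; congr (_ || _).
by apply: eq_existsb => l; rewrite andbC.
Qed.

Lemma glue_trans : transitive glue.
Proof.
move=> q p r pq qr; case/orP: (pq) => [/eqP->//|/existsP[l /andP[pl ql]]].
apply/orP; right; apply/existsP; exists l.
by rewrite pl -(glue_snd qr) ql.
Qed.

(* The identified vertices are the equivalence classes of glue. *)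
Definition square_vertex : Type :=
  {C : {set bool * K} | C \in equivalence_partition glue setT}.

Lemma square_vertex_class (u : square_vertex) p q :
  p \in val u -> q \in val u -> glue p q.
Proof.
case/imsetP: (valP u) => r _ ->; rewrite !inE /= glue_sym => rp rq.
exact: glue_trans rp rq.
Qed.

(* Being a relation on classes, this merges the double edges between labeled *)
(* vertices.                                                                 *)
Definition square_adj : rel square_vertex :=
  fun u w => [exists p in val u, exists q in val w, copies_adj p q].

Lemma square_adj_sym : symmetric square_adj.
Proof.
suff sub u w : square_adj u w -> square_adj w u.
  by move=> u w; apply/idP/idP; exact: sub.
case/exists_inP=> p pu /exists_inP[q qw]; rewrite /copies_adj.
rewrite eq_sym adj_sym => pq.
by apply/exists_inP; exists q => //; apply/exists_inP; exists p.
Qed.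

Lemma square_adj_irrefl : irreflexive square_adj.
Proof.
move=> u; apply/negbTE/negP => /exists_inP[p pu /exists_inP[q qu]].
by rewrite /copies_adj (glue_snd (square_vertex_class pu qu)) adj_irrefl andbF.
Qed.

Lemma square_vertex_gt0 : 0 < #|{: square_vertex}|.
Proof.
have /card_gt0P[v _] := vertex_gt0 K.
pose C := [set q in setT | glue (true, v) q].
have CP : C \in equivalence_partition glue setT by exact: imset_f.
by apply/card_gt0P; exists (Sub C CP).
Qed.

Definition square : sgraph :=
  SGraph square_adj_sym square_adj_irrefl square_vertex_gt0.
End Square.

Definition is_square (G : sgraph) : Prop :=
  exists K : plgraph, isomorphic G (square K).

(* Main.v *)
Require Import Defs.
From mathcomp Require Import all_boot finmap.

Set Implicit Arguments.
Unset Strict Implicit.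
Unset Printing Implicit Defensive.

(* A graph is a square iff it has a reflection: an involutive automorphism s  *)
(* with a fixed vertex, together with a nonempty set A such that A, s A and   *)
(* the fixed vertices of s partition the vertex set and no edge joins A to    *)
(* s A.  If (s, A) is a reflection of G, then (s x id, A x V(H)) is one of    *)
(* the product of G with H.  For the product of H with G the reflection has   *)
(* to be confined to a single copy {h0} x V(G), all other vertices staying    *)
(* fixed, since reflecting two adjacent copies would join A to s A.           *)

(** A square is reflected by exchanging its two copies: the labeled vertices are fixed and the
    unlabeled part of the first copy serves as [A] ([square_reflection]); [reflection_iso] carries
    this over to isomorphic graphs. Conversely, a reflection cuts the graph along its fixed vertices
    into two halves that [s] exchanges, so the graph is the square of one half labeled at the fixed
    vertices ([is_square_reflection]). It remains to reflect the two products: [lexprod_reflectionl]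
    and [lexprod_reflectionr]. *)

Section Reflection.
Variable G : sgraph.

Record reflection (s : G -> G) (A : pred G) : Prop := Reflection {
  refl_inv : involutive s;
  refl_adj : forall x y, adj (s x) (s y) = adj x y;
  refl_disj : forall x, A x -> ~~ A (s x);
  refl_fix : forall x, (s x == x) = ~~ A x && ~~ A (s x);
  refl_nadj : forall x y, A x -> A y -> ~~ adj x (s y);
  refl_ex_fix : exists x, s x == x;
  refl_ex_side : exists x, A x
}.

End Reflection.

Lemma reflection_iso (G G' : sgraph) (s : G' -> G') (A : pred G') :
  isomorphic G G' -> reflection s A ->
  exists (s' : G -> G) (A' : pred G), reflection s' A'.
Proof.
case=> f [g fK gK] fadj [sI sadj sdisj sfix snadj [x0 fx0] [x1 Ax1]].
exists (fun x => g (s (f x))), (fun x => A (f x)); split=> [x|x y|x|x|x y||].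
- by rewrite gK sI fK.
- by rewrite -fadj !gK sadj fadj.
- by rewrite gK; exact: sdisj.
- by rewrite gK -sfix -(can_eq fK) gK.
- by rewrite -fadj gK; exact: snadj.
- by exists (g x0); rewrite gK (eqP fx0).
- by exists (g x1); rewrite gK.
Qed.

(** * The reflection carried by a square *)

Section SquareClass.
Variable K : plgraph.
Implicit Types p q : bool * K.

Definition labeled (v : K) := v \in codom (@theta K).

Lemma glueE p q : glue p q = (p.2 == q.2) && ((p.1 == q.1) || labeled p.2).
Proof.
rewrite /glue; case: p q => [a v] [b w] /=; rewrite xpair_eqE.
have -> : [exists l : labels K, (v == theta l) && (w == theta l)] =
          (v == w) && labeled v.
  apply/existsP/andP => [[l /andP[/eqP-> /eqP->]]|[/eqP<- /codomP[l ->]]].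
    by split=> //; exact: codom_f.
  by exists l; rewrite eqxx.
by rewrite andbC andb_orr.
Qed.

Definition class p : square K :=
  Sub [set q in setT | glue p q] (imset_f _ (in_setT p)).

Lemma in_class p q : (q \in val (class p)) = glue p q.
Proof. by rewrite SubK !inE. Qed.

Lemma class_surj (u : square K) : exists p, u == class p.
Proof.
case/imsetP: (valP u) => p _ up; exists p.
by rewrite -val_eqE SubK up.
Qed.

Lemma class_eq p q : (class p == class q) = glue p q.
Proof.
rewrite -val_eqE; apply/eqP/idP => [e|pq].
  by rewrite -in_class e in_class glue_refl.
apply/setP => r; rewrite !in_class; apply/idP/idP; last exact: glue_trans.
by apply: glue_trans; rewrite glue_sym.
Qed.

(** The two representatives of an edge must lie in the same copy, and a representative can change
    copy only at a labeled vertex. *)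
Lemma adj_class p q :
  adj (class p) (class q) =
  adj p.2 q.2 && [|| p.1 == q.1, labeled p.2 | labeled q.2].
Proof.
apply/exists_inP/idP => [[p']|].
  rewrite in_class glueE => /andP[/eqP-> pp'] /exists_inP[q'].
  rewrite in_class glueE => /andP[/eqP-> qq'] /andP[/eqP e ->] /=.
  case/orP: pp' => [/eqP->|->]; last by rewrite orbT.
  by case/orP: qq' => [/eqP->|->]; rewrite ?e ?eqxx ?orbT.
case: p q => [a v] [b w] /= /andP[vw].
case/or3P => [/eqP e|lv|lw].
- exists (a, v); first by rewrite in_class glue_refl.
  apply/exists_inP; exists (b, w); first by rewrite in_class glue_refl.
  by rewrite /copies_adj /= e eqxx.
- exists (b, v); first by rewrite in_class glueE /= eqxx lv orbT.
  apply/exists_inP; exists (b, w); first by rewrite in_class glue_refl.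
  by rewrite /copies_adj /= eqxx.
- exists (a, v); first by rewrite in_class glue_refl.
  apply/exists_inP; exists (a, w); last by rewrite /copies_adj /= eqxx.
  by rewrite in_class glueE /= eqxx lw orbT.
Qed.

(** At a labeled vertex the copy chosen here is arbitrary; [swap_copies_class] and
    [first_copy_class] show that the choice does not matter. *)
Definition class_repr (u : square K) : bool * K := xchoose (class_surj u).

Lemma class_reprK u : class (class_repr u) = u.
Proof. by have /eqP <- := xchooseP (class_surj u). Qed.

Definition swap_copies (u : square K) : square K :=
  let p := class_repr u in class (~~ p.1, p.2).

Definition first_copy : pred (square K) :=
  fun u => let p := class_repr u in p.1 && ~~ labeled p.2.

Lemma class_repr_glue p : glue (class_repr (class p)) p.
Proof. by rewrite -class_eq class_reprK. Qed.

Lemma swap_copies_class b v : swap_copies (class (b, v)) = class (~~ b, v).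
Proof.
have := class_repr_glue (b, v); rewrite /swap_copies glueE /=.
case: (class_repr _) => c w /= /andP[/eqP-> /orP[/eqP->//|lv]].
by apply/eqP; rewrite class_eq glueE /= eqxx lv orbT.
Qed.

Lemma first_copy_class b v : first_copy (class (b, v)) = b && ~~ labeled v.
Proof.
have := class_repr_glue (b, v); rewrite /first_copy glueE /=.
case: (class_repr _) => c w /= /andP[/eqP-> /orP[/eqP->//|->]].
by rewrite !andbF.
Qed.

Lemma square_reflection : reflection swap_copies first_copy.
Proof.
have cP u : exists b v, u = class (b, v).
  by have [[b v] /eqP->] := class_surj u; exists b, v.
split.
- by move=> u; have [b [v ->]] := cP u; rewrite !swap_copies_class negbK.
- move=> u u'; have [b [v ->]] := cP u; have [b' [v' ->]] := cP u'.
  by rewrite !swap_copies_class !adj_class /= (inj_eq negb_inj).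
- move=> u; have [b [v ->]] := cP u.
  by rewrite swap_copies_class !first_copy_class => /andP[-> ].
- move=> u; have [b [v ->]] := cP u.
  rewrite swap_copies_class !first_copy_class class_eq glueE /= eqxx.
  by case: b (labeled v) => [] [].
- move=> u u'; have [b [v ->]] := cP u; have [b' [v' ->]] := cP u'.
  rewrite swap_copies_class !first_copy_class adj_class /=.
  by move=> /andP[-> /negbTE->] /andP[-> /negbTE->]; rewrite andbF.
- have [v lv] := theta_nonempty K; exists (class (true, v)).
  by rewrite swap_copies_class class_eq glueE /= eqxx /labeled lv.
- have [v lv] := theta_proper K; exists (class (true, v)).
  by rewrite first_copy_class.
Qed.

End SquareClass.

(** * Partially labeled graphs from vertex sets, and induced subgraphs *)

Section LabelSet.
Variables (K : sgraph) (L : {set K}) (v0 v1 : K).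
Hypotheses (v0L : v0 \in L) (v1L : v1 \notin L).

Definition set_labels : {fset nat} := [fset i in iota 0 #|L|]%fset.

(** Labels are positions in the enumeration of [L], so the default [v0] is never returned. *)
Definition set_theta (l : set_labels) : K := nth v0 (enum L) (val l).

Lemma set_labels_lt (l : set_labels) : val l < size (enum L).
Proof. by have := valP l; rewrite !inE /= mem_iota -cardE. Qed.

Lemma set_theta_inj : injective set_theta.
Proof.
move=> k l /eqP; rewrite nth_uniq ?enum_uniq ?set_labels_lt //.
by move/eqP/val_inj.
Qed.

Lemma codom_set_theta v : (v \in codom set_theta) = (v \in L).
Proof.
apply/codomP/idP => [[l ->]|vL].
  by rewrite -mem_enum mem_nth ?set_labels_lt.
have lt : index v (enum L) \in set_labels.
  by rewrite !inE /= mem_iota /= add0n cardE index_mem mem_enum.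
by exists (Sub (index v (enum L)) lt); rewrite /set_theta nth_index ?mem_enum.
Qed.

Lemma set_theta_nonempty : exists v, v \in codom set_theta.
Proof. by exists v0; rewrite codom_set_theta. Qed.

Lemma set_theta_proper : exists v, v \notin codom set_theta.
Proof. by exists v1; rewrite codom_set_theta. Qed.

Definition set_plgraph : plgraph :=
  PLGraph set_theta_inj set_theta_nonempty set_theta_proper.

Lemma labeled_set_plgraph v : @labeled set_plgraph v = (v \in L).
Proof. exact: codom_set_theta. Qed.

End LabelSet.

Section Induced.
Variables (G : sgraph) (B : pred G) (x0 : G).
Hypothesis Bx0 : B x0.

Definition induced_adj : rel {x : G | B x} := fun u v => adj (val u) (val v).

Lemma induced_adj_sym : symmetric induced_adj.
Proof. by move=> u v; exact: adj_sym. Qed.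

Lemma induced_adj_irrefl : irreflexive induced_adj.
Proof. by move=> u; exact: adj_irrefl. Qed.

Lemma induced_gt0 : 0 < #|{: {x : G | B x}}|.
Proof. by apply/card_gt0P; exists (Sub x0 Bx0). Qed.

Definition induced : sgraph :=
  SGraph induced_adj_sym induced_adj_irrefl induced_gt0.

End Induced.

(** * From a reflection back to a square *)

Lemma inj_surj_bij (T T' : finType) (f : T -> T') :
  injective f -> (forall y, exists x, f x = y) -> bijective f.
Proof.
move=> f_inj f_surj; apply: inj_card_bij => //.
rewrite -(card_codom f_inj); apply/subset_leq_card/subsetP => y _.
by have [x <-] := f_surj y; exact: codom_f.
Qed.

(* The half K is induced on A and the fixed vertices; the latter are labeled. *)
Lemma is_square_reflection (G : sgraph) (s : G -> G) (A : pred G) :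
  reflection s A -> is_square G.
Proof.
case=> sI sadj sdisj sfix snadj [x0 fx0] [x1 Ax1].
(* The complement of [s A], that is, [A] together with the fixed vertices. *)
pose B : pred G := fun x => ~~ A (s x).
have Bx0 : B x0 by move: fx0; rewrite sfix => /andP[].
have Bx1 : B x1 by exact: sdisj.
pose K := induced Bx0.
pose L : {set K} := [set v | s (val v) == val v].
have v0L : (Sub x0 Bx0 : K) \in L by rewrite inE.
have v1L : (Sub x1 Bx1 : K) \notin L by rewrite inE sfix Ax1.
pose P := set_plgraph v0L v1L.
(* Folds [s A] onto [A] and leaves the rest in place. *)
pose fold x := if B x then x else s x.
have Bfold x : B (fold x).
  rewrite /fold; case: ifP => // /negbFE; rewrite /B sI.
  by move=> /sdisj; rewrite sI.
pose fv x : P := Sub (fold x) (Bfold x).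
have lab v : @labeled P v = (s (val v) == val v).
  by rewrite labeled_set_plgraph inE.
have fixB x : s x == x -> (fold x = x) * (A x = false).
  by rewrite sfix /fold /B => /andP[/negbTE-> ->].
have sideA x : A x -> (fold x = x) * ((s x == x) = false).
  by move=> Ax; rewrite /fold /B sfix Ax sdisj.
have sideS x : A (s x) -> [/\ fold x = s x, A x = false & (s x == x) = false].
  move=> Ax; rewrite /fold /B sfix Ax andbF; split=> //.
  by apply/negbTE; have := sdisj _ Ax; rewrite sI.
have tri x : [\/ s x == x, A x | A (s x)].
  have := sfix x; case: (A x); first by constructor 2.
  case: (A (s x)); first by constructor 3.
  by move=> /= ->; constructor 1.
have sfold x : (s (fold x) == fold x) = (s x == x).
  by rewrite /fold; case: ifP => // _; rewrite (can_eq sI).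
(* [A] goes to the first copy and [s A] to the second; a fixed vertex is labeled, so its copy is
   immaterial. *)
pose f x : square P := class (A x, fv x).
have fE x y : (f x == f y) =
    (fold x == fold y) && ((A x == A y) || (s x == x)).
  by rewrite class_eq glueE /= lab -val_eqE !SubK sfold.
exists P, f; first (apply: inj_surj_bij => [x y /eqP|u]).
- rewrite fE => /andP[/eqP e].
  case: (tri x) => [fx _|Ax|Ax].
  + have fy : s y == y by rewrite -sfold -e sfold.
    by move: e; rewrite (fixB _ fx).1 (fixB _ fy).1.
  + rewrite (sideA _ Ax).2 orbF Ax => /eqP Ay; move: e.
    by rewrite (sideA _ Ax).1 (sideA _ (esym Ay)).1.
  + have [ex nAx nfx] := sideS _ Ax; rewrite nAx nfx orbF.
    case: (tri y) => [fy|->//|Ay _].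
      by move: nfx; rewrite -sfold e sfold fy.
    by have [ey _ _] := sideS _ Ay; apply: (can_inj sI); rewrite -ex e ey.
- have [[b v] /eqP->] := class_surj u.
  case: (tri (val v)) => [fx|Ax|Ax].
  + exists (val v); apply/eqP; rewrite class_eq glueE /= lab -val_eqE !SubK.
    by rewrite sfold fx orbT andbT (fixB _ fx).1.
  (* An unlabeled vertex of the half comes from itself in the first copy and from its mirror image
     in the second. *)
  + exists (if b then val v else s (val v)); apply/eqP.
    rewrite class_eq glueE /= lab -val_eqE !SubK.
    case: b; first by rewrite (sideA _ Ax).1 Ax !eqxx.
    have Ax' : A (s (s (val v))) by rewrite sI.
    by have [-> -> _] := sideS _ Ax'; rewrite sI !eqxx.
  + by have := valP v; rewrite /B Ax.
- move=> x y; rewrite adj_class !lab !SubK !sfold.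
  rewrite -[adj (_, fv x).2 (_, fv y).2]/(adj (fold x) (fold y)) /=.
  (* Between [A] and [s A] both sides are false. In all other cases folding either changes nothing
     or amounts to applying [s] to both ends. *)
  case: (tri x) => [fx|Ax|Ax].
  + rewrite fx orbT andbT (fixB _ fx).1 /fold; case: ifP => // _.
    by rewrite -{1}(eqP fx) sadj.
  + have [-> ->] := sideA _ Ax; rewrite Ax.
    case: (tri y) => [fy|Ay|Ay].
    * by rewrite fy !orbT andbT (fixB _ fy).1.
    * by have [-> _] := sideA _ Ay; rewrite Ay andbT.
    have [_ -> ->] := sideS _ Ay; rewrite andbF.
    by have /negbTE := snadj _ _ Ax Ay; rewrite sI.
  + have [-> -> ->] := sideS _ Ax.
    case: (tri y) => [fy|Ay|Ay].
    * by rewrite fy !orbT andbT (fixB _ fy).1 -{1}(eqP fy) sadj.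
    * have [_ ->] := sideA _ Ay; rewrite Ay andbF adj_sym.
      by have /negbTE := snadj _ _ Ay Ax; rewrite sI.
    by have [-> -> _] := sideS _ Ay; rewrite andbT sadj.
Qed.

(** * Reflections of the lexicographic products *)

Lemma lexprod_reflectionl (G H : sgraph) (s : G -> G) (A : pred G) :
  reflection s A ->
  @reflection (lexprod G H) (fun p => (s p.1, p.2)) (fun p => A p.1).
Proof.
case=> sI sadj sdisj sfix snadj [x0 fx0] [x1 Ax1].
have /card_gt0P[y0 _] := vertex_gt0 H.
split=> [[x y]|[x y] [x' y']|[x y]|[x y]|[x y] [x' y']||] /=.
- by rewrite sI.
- by rewrite /lex_adj /= sadj (can_eq sI).
- exact: sdisj.
- by rewrite xpair_eqE eqxx andbT sfix.
- move=> Ax Ax'; rewrite /lex_adj /= (negbTE (snadj _ _ Ax Ax')) /=.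
  (* An edge inside one copy of [H] would need a vertex common to [A] and [s A]. *)
  by apply/negP => /andP[/eqP e _]; have := sdisj _ Ax'; rewrite -e Ax.
- by exists (x0, y0); rewrite /= (eqP fx0).
- by exists (x1, y0).
Qed.

(** A vertex outside the copy over [h0] is adjacent to all of that copy or to none of it, so
    permuting the copy by an automorphism of [G] preserves adjacency. *)
Lemma lexprod_reflectionr (G H : sgraph) (s : G -> G) (A : pred G) (h0 : H) :
  reflection s A ->
  @reflection (lexprod H G)
    (fun p => (p.1, if p.1 == h0 then s p.2 else p.2))
    (fun p => (p.1 == h0) && A p.2).
Proof.
case=> sI sadj sdisj sfix snadj [x0 fx0] [x1 Ax1].
split=> [[h x]|[h x] [h' x']|[h x]|[h x]|[h x] [h' x']||] /=.
- by case: eqP => // _; rewrite sI.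
- rewrite /lex_adj /=; case: (h =P h') => [<-|] //=.
  by case: eqP => // _; rewrite sadj.
- by case: eqP => //= _; exact: sdisj.
- by rewrite xpair_eqE eqxx /=; case: (h == h0) => //=; rewrite eqxx.
- case/andP=> /eqP-> Ax /andP[/eqP-> Ax'].
  by rewrite /lex_adj /= adj_irrefl eqxx /=; exact: snadj.
- by exists (h0, x0); rewrite /= eqxx (eqP fx0).
- by exists (h0, x1); rewrite /= eqxx.
Qed.

Theorem theorem5p7 (G H : sgraph) :
  is_square G -> is_square (lexprod G H) /\ is_square (lexprod H G).
Proof.
case=> K GK; have [s [A sA]] := reflection_iso GK (square_reflection K).
have /card_gt0P[h0 _] := vertex_gt0 H; split.
  exact: is_square_reflection (lexprod_reflectionl H sA).
exact: is_square_reflection (lexprod_reflectionr h0 sA).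
Qed.
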